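(* Let $R$ be a semisimple ring. Then $R$ is a $2$-$\sqrt{J}U$ ring if and only if $R\cong\prod_{i=1}^{k}R_i$ for some positive integer $k$ and rings $R_1,\dots,R_k$, where each $R_i$ is isomorphic to $\mathbb{F}_2$ or to $\mathbb{F}_3$.
   Context: All rings are associative with identity $1\neq 0$. For a ring $R$, $J(R)$ denotes the Jacobson radical, $U(R)$ the group of units, and $\sqrt{J(R)}=\{x\in R : x^m\in J(R)\text{ for some } m\ge 1\}$. A ring $R$ is a $2$-$\sqrt{J}U$ ring if $u^2\in 1+\sqrt{J(R)}$ for every $u\in U(R)$. Semisimple is meant in the sense of Wedderburn–Artin: $R\cong\prod_{i=1}^{k}M_{m_i}(D_i)$ for some positive integers $k,m_1,\dots,m_k$ and division rings $D_i$. $\mathbb{F}_q$ denotes the field with $q$ elements. *)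

(* Defs.v *)
From HB Require Import structures.
From mathcomp Require Import all_boot all_order all_algebra.

Set Implicit Arguments.
Unset Strict Implicit.
Unset Printing Implicit Defensive.

Import GRing.Theory.
Local Open Scope ring_scope.

(* An nzRingType carries no unit predicate, and neither U(R) nor the ideals
   of R need be decidable, so subsets of R are Prop-valued here. *)
Definition is_unit (R : pzRingType) (u : R) : Prop :=
  exists v : R, v * u = 1 /\ u * v = 1.

Definition division_ring (D : nzRingType) : Prop :=
  forall x : D, x != 0 -> is_unit x.

Record left_ideal (R : pzRingType) (I : R -> Prop) : Prop := LeftIdeal {
  left_ideal0 : I 0;
  left_idealD : forall x y : R, I x -> I y -> I (x + y);
  left_idealM : forall a x : R, I x -> I (a * x)
}.

Definition proper_left_ideal (R : pzRingType) (I : R -> Prop) : Prop :=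
  left_ideal I /\ ~ (forall x : R, I x).

Definition maximal_left_ideal (R : pzRingType) (I : R -> Prop) : Prop :=
  proper_left_ideal I /\
  forall K : R -> Prop, proper_left_ideal K ->
    (forall x : R, I x -> K x) -> forall x : R, K x -> I x.

Definition jacobson (R : pzRingType) (x : R) : Prop :=
  forall I : R -> Prop, maximal_left_ideal I -> I x.

Definition sqrt_jacobson (R : pzRingType) (x : R) : Prop :=
  exists m : nat, (0 < m)%N /\ jacobson (x ^+ m).

Definition two_sqrtJU (R : pzRingType) : Prop :=
  forall u : R, is_unit u ->
    exists j : R, sqrt_jacobson j /\ u ^+ 2 = 1 + j.

Definition ring_iso (R S : pzRingType) : Prop :=
  exists f : {rmorphism R -> S}, bijective f.

(* MathComp only provides ring structures on {ffun I -> R} with a constant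
   codomain. The product is only a pzRingType: it is trivial when I is empty. *)
Definition ring_prod (I : finType) (R : I -> pzRingType) : Type :=
  {dffun forall i : I, R i}.

Section RingProd.
Variables (I : finType) (R : I -> pzRingType).
Local Notation T := (ring_prod R).

HB.instance Definition _ := Choice.copy T {dffun forall i : I, R i}.

Definition ring_prod0 : T := [ffun i => 0 : R i].
Definition ring_prod1 : T := [ffun i => 1 : R i].
Definition ring_prodN (f : T) : T := [ffun i => - (f i : R i)].
Definition ring_prodD (f g : T) : T := [ffun i => (f i : R i) + g i].
Definition ring_prodM (f g : T) : T := [ffun i => (f i : R i) * g i].

Fact ring_prod_addrA : associative ring_prodD.
Proof. by move=> f g h; apply/ffunP=> i; rewrite !ffunE addrA. Qed.
Fact ring_prod_addrC : commutative ring_prodD.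
Proof. by move=> f g; apply/ffunP=> i; rewrite !ffunE addrC. Qed.
Fact ring_prod_add0r : left_id ring_prod0 ring_prodD.
Proof. by move=> f; apply/ffunP=> i; rewrite !ffunE add0r. Qed.
Fact ring_prod_addNr : left_inverse ring_prod0 ring_prodN ring_prodD.
Proof. by move=> f; apply/ffunP=> i; rewrite !ffunE addNr. Qed.
Fact ring_prod_mulrA : associative ring_prodM.
Proof. by move=> f g h; apply/ffunP=> i; rewrite !ffunE mulrA. Qed.
Fact ring_prod_mul1r : left_id ring_prod1 ring_prodM.
Proof. by move=> f; apply/ffunP=> i; rewrite !ffunE mul1r. Qed.
Fact ring_prod_mulr1 : right_id ring_prod1 ring_prodM.
Proof. by move=> f; apply/ffunP=> i; rewrite !ffunE mulr1. Qed.
Fact ring_prod_mulrDl : left_distributive ring_prodM ring_prodD.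
Proof. by move=> f g h; apply/ffunP=> i; rewrite !ffunE mulrDl. Qed.
Fact ring_prod_mulrDr : right_distributive ring_prodM ring_prodD.
Proof. by move=> f g h; apply/ffunP=> i; rewrite !ffunE mulrDr. Qed.

HB.instance Definition _ := GRing.isZmodule.Build T
  ring_prod_addrA ring_prod_addrC ring_prod_add0r ring_prod_addNr.
HB.instance Definition _ := GRing.Zmodule_isPzRing.Build T
  ring_prod_mulrA ring_prod_mul1r ring_prod_mulr1
  ring_prod_mulrDl ring_prod_mulrDr.

End RingProd.

Definition semisimple (R : nzRingType) : Prop :=
  exists (k : nat) (m : 'I_k -> nat) (D : 'I_k -> nzRingType),
    [/\ (0 < k)%N, forall i, (0 < m i)%N, forall i, division_ring (D i) &
        ring_iso R (ring_prod (fun i : 'I_k => 'M[D i]_(m i)))].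

(* Main.v *)
Require Import Defs.
From mathcomp Require Import all_boot all_order all_algebra.
From HB Require Import structures.

(** The key observation is that in a semisimple ring the Jacobson radical is
    trivial, so that the 2-sqrt(J)U property says that u ^+ 2 - 1 is nilpotent
    for every unit u, and that this passes to each factor 'M[D]_n of the
    Wedderburn-Artin decomposition since units of a factor extend by 1
    ([unit_sqr_nil_component]).

    Only two facts about the radical are needed: it is mapped into the radical
    by surjective morphisms ([jacobson_rmorph]), and it is zero for 'M[D]_n
    with D a division ring, because the matrices whose j-th column vanishes
    form a maximal left ideal ([jacobson_matrix]).

    If n >= 2, the matrix g = E_aa + E_ab + E_ba is invertible in the corner
    ring of the idempotent e = E_aa + E_bb, and satisfies g * g = g + e.
    Hence u = g + (1 - e) is a unit with u ^+ 2 - 1 = g, which is not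
    nilpotent ([no_golden_corner]).  So n = 1, and u ^+ 2 - 1 = 0 for every
    nonzero u in D; thus D = {0, 1, -1}, which is F_2 or F_3.

    Conversely every unit of a product of copies of F_2 and F_3 squares
    to 1. *)

Set Implicit Arguments.
Unset Strict Implicit.
Unset Printing Implicit Defensive.

Import GRing.Theory.
Local Open Scope ring_scope.

(** * Isomorphisms and units *)

Lemma ring_isoP (R S : pzRingType) : ring_iso R S ->
  exists (f : {rmorphism R -> S}) (g : {rmorphism S -> R}),
    cancel f g /\ cancel g f.
Proof.
case=> f [g fK gK].
have injf := can_inj fK.
have gB : zmod_morphism g by move=> x y; apply: injf; rewrite rmorphB !gK.
have gM : monoid_morphism g.
  split; first by apply: injf; rewrite gK rmorph1.
  by move=> x y; apply: injf; rewrite rmorphM !gK.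
pose ga := GRing.isZmodMorphism.Build S R g gB.
pose gm := GRing.isMonoidMorphism.Build S R g gM.
pose G : {rmorphism S -> R} := HB.pack g ga gm.
by exists f, G.
Qed.

Lemma ring_iso_sym (R S : pzRingType) : ring_iso R S -> ring_iso S R.
Proof. by case/ring_isoP=> f [g [fK gK]]; exists g; exists f. Qed.

Lemma ring_iso_trans (R S T : pzRingType) :
  ring_iso R S -> ring_iso S T -> ring_iso R T.
Proof.
by case=> f fbij [g gbij]; exists (g \o f : {rmorphism R -> T}); apply: bij_comp.
Qed.

Lemma is_unit_rmorph (R S : pzRingType) (f : {rmorphism R -> S}) (u : R) :
  is_unit u -> is_unit (f u).
Proof. by case=> v [vu uv]; exists (f v); rewrite -!rmorphM vu uv rmorph1. Qed.

(** * Direct products *)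

Section RingProduct.
Variables (I : finType) (A : I -> pzRingType).

(** The projection of a product of rings onto its [i]-th component. *)
Definition ring_proj (i : I) (x : ring_prod A) : A i := x i.

Fact ring_proj_zmod i : zmod_morphism (@ring_proj i).
Proof. by move=> x y; rewrite /ring_proj !ffunE. Qed.

Fact ring_proj_monoid i : monoid_morphism (@ring_proj i).
Proof. by split=> [|x y]; rewrite /ring_proj !ffunE. Qed.

HB.instance Definition _ i :=
  GRing.isZmodMorphism.Build (ring_prod A) (A i) (@ring_proj i)
    (@ring_proj_zmod i).
HB.instance Definition _ i :=
  GRing.isMonoidMorphism.Build (ring_prod A) (A i) (@ring_proj i)
    (@ring_proj_monoid i).

(** The element of the product with component [a] at [i] and 1 elsewhere,
    so that this map is multiplicative and unital, but in general not additive. *)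
Definition ring_inj (i : I) (a : A i) : ring_prod A :=
  [ffun j => dfwith (fun j => 1 : A j) a j].

Lemma ring_injK i : cancel (@ring_inj i) (@ring_proj i).
Proof. by move=> a; rewrite /ring_proj ffunE dfwith_in. Qed.

Lemma ring_injM i (a b : A i) : ring_inj (a * b) = ring_inj a * ring_inj b.
Proof.
apply/ffunP=> j; rewrite !ffunE.
have [<-|ij] := eqVneq i j; first by rewrite !dfwith_in.
by rewrite !dfwith_out // mulr1.
Qed.

Lemma ring_inj1 i : ring_inj (1 : A i) = 1.
Proof.
apply/ffunP=> j; rewrite !ffunE.
by have [<-|ij] := eqVneq i j; rewrite ?dfwith_in ?dfwith_out.
Qed.

Lemma is_unit_ring_inj i (a : A i) : is_unit a -> is_unit (ring_inj a).
Proof.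
by case=> b [ba ab]; exists (ring_inj b); rewrite -!ring_injM ba ab ring_inj1.
Qed.

End RingProduct.

Lemma ring_prod_iso (I : finType) (A B : I -> pzRingType) :
  (forall i, ring_iso (A i) (B i)) -> ring_iso (ring_prod A) (ring_prod B).
Proof.
move=> /fin_all_exists[f fbij].
have /fin_all_exists[g gP] i : exists g, cancel (f i) g /\ cancel g (f i).
  by case: (fbij i) => g; exists g.
pose F (x : ring_prod A) : ring_prod B := [ffun i => f i (x i)].
pose G (y : ring_prod B) : ring_prod A := [ffun i => g i (y i)].
have FB : zmod_morphism F by move=> x y; apply/ffunP=> i; rewrite !ffunE rmorphB.
have FM : monoid_morphism F.
  split=> [|x y]; apply/ffunP=> i; rewrite !ffunE ?rmorph1 //.
  by rewrite rmorphM.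
pose Fa := GRing.isZmodMorphism.Build _ _ F FB.
pose Fm := GRing.isMonoidMorphism.Build _ _ F FM.
pose Fr : {rmorphism ring_prod A -> ring_prod B} := HB.pack F Fa Fm.
by exists Fr; exists G => x; apply/ffunP=> i; rewrite !ffunE; case: (gP i).
Qed.

(** * The Jacobson radical *)

Lemma jacobson0 (R : pzRingType) : @jacobson R 0.
Proof. by move=> I [[[]]]. Qed.

Lemma maximal_left_ideal_preim (R S : pzRingType) (f : {rmorphism R -> S})
    (I : S -> Prop) :
    (forall y, exists x, f x = y) ->
  maximal_left_ideal I -> maximal_left_ideal (fun x => I (f x)).
Proof.
move=> fsurj [[[I0 ID IM] Iproper] Imax]; split.
  split; first split=> [|x y|a x]; rewrite ?rmorph0 ?rmorphD ?rmorphM //.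
  - exact: ID.
  - exact: IM.
  by move=> Iall; apply: Iproper => y; have [x <-] := fsurj y.
move=> K [[K0 KD KM] Kproper] IK x Kx.
apply: (Imax (fun y => exists2 x, f x = y & K x)); last by exists x.
  split; first split.
  - by exists 0; rewrite ?rmorph0.
  - move=> _ _ [y <- Ky] [z <- Kz].
    by exists (y + z); rewrite ?rmorphD //; apply: KD.
  - move=> b _ [y <- Ky]; have [a <-] := fsurj b.
    by exists (a * y); rewrite ?rmorphM //; apply: KM.
  (* K contains the kernel of f, so it is determined by its image. *)
  move=> Kall; apply: Kproper => z; have [y fyz Ky] := Kall (f z).
  rewrite -(subrK y z); apply: KD => //; apply: IK.
  by rewrite rmorphB fyz subrr.
by move=> y Iy; have [z fz] := fsurj y; exists z => //; apply: IK; rewrite fz.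
Qed.

Lemma jacobson_rmorph (R S : pzRingType) (f : {rmorphism R -> S}) (x : R) :
  (forall y, exists x, f x = y) -> jacobson x -> jacobson (f x).
Proof. by move=> fsurj Jx I /(maximal_left_ideal_preim fsurj)/Jx. Qed.

Section MatrixDivisionRing.
Variables (D : nzRingType) (n : nat).
Hypothesis divD : division_ring D.

Lemma maximal_left_ideal_col (j : 'I_n) :
  maximal_left_ideal (fun A : 'M[D]_n => col j A = 0).
Proof.
split.
  split; first split.
  - exact: raddf0.
  - by move=> A B A0 B0; rewrite raddfD /= A0 B0 addr0.
  - by move=> A B B0; rewrite colE -mulmxA -colE B0 mulmx0.
  move=> /(_ 1) /colP/(_ j)/eqP.
  by rewrite !mxE eqxx oner_eq0.
move=> K [[K0 KD KM] Kproper] IK A KA.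
apply/colP=> r; rewrite !mxE; apply/eqP/negP => /negP/divD[d [dA _]].
(* Left multiples of A attain every possible j-th column. *)
case: Kproper => B.
pose C : 'M[D]_n := \matrix_(s, t) (if t == r then B s j * d else 0).
rewrite -(subrK (C * A) B); apply: KD; last exact: KM.
apply: IK; apply/colP=> s; rewrite !mxE (bigD1 r) //= big1 => [|t /negPf tr].
  by rewrite mxE eqxx -mulrA dA mulr1 addr0 subrr.
by rewrite mxE tr mul0r.
Qed.

Lemma jacobson_matrix (A : 'M[D]_n) : jacobson A -> A = 0.
Proof.
move=> JA; apply/matrixP=> i j.
have /colP/(_ i) := JA _ (maximal_left_ideal_col j).
by rewrite !mxE.
Qed.

End MatrixDivisionRing.

(** * Units with nilpotent [u ^+ 2 - 1] *)

(** What the 2-sqrt(J)U property amounts to when the radical is zero: the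
    element u ^+ 2 - 1 is nilpotent for every unit u. *)
Definition unit_sqr_nil (R : pzRingType) : Prop :=
  forall u : R, is_unit u -> exists m : nat, (u ^+ 2 - 1) ^+ m = 0.

(** The section [f'] of [f] need not be a morphism: it only has to lift units to
    units. This allows for the unital lifts from a factor to a product. *)
Lemma two_sqrtJU_unit_sqr_nil (R S : pzRingType) (f : {rmorphism R -> S})
    (f' : S -> R) :
    cancel f' f -> (forall u, is_unit u -> is_unit (f' u)) ->
    (forall x : S, jacobson x -> x = 0) ->
  two_sqrtJU R -> unit_sqr_nil S.
Proof.
move=> f'K f'unit JS0 JU u /f'unit/JU[j [[m [_ Jjm]] sqr_u]].
exists m; apply: JS0.
have -> : u ^+ 2 - 1 = f j.
  by rewrite -{1}[u]f'K -rmorphXn sqr_u rmorphD rmorph1 addrC addKr.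
by rewrite -rmorphXn; apply: jacobson_rmorph Jjm => y; exists (f' y).
Qed.

Lemma unit_sqr_nil_component (R : pzRingType) (I : finType) (m : I -> nat)
    (D : I -> nzRingType) (i : I) :
    division_ring (D i) -> ring_iso R (ring_prod (fun i => 'M[D i]_(m i))) ->
  two_sqrtJU R -> unit_sqr_nil 'M[D i]_(m i).
Proof.
move=> divD /ring_isoP[f [g [fK gK]]].
apply: (@two_sqrtJU_unit_sqr_nil _ _ (ring_proj i \o f)
          (fun u => g (ring_inj u))) => [u|u u_unit|u].
- by rewrite /= gK; apply: (@ring_injK _ (fun i => 'M[D i]_(m i)) i).
- apply: (is_unit_rmorph g).
  exact: (@is_unit_ring_inj _ (fun i => 'M[D i]_(m i)) i).
- exact: jacobson_matrix.
Qed.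

(** The obstruction for matrices of size at least 2: a nonzero idempotent [e]
    whose corner ring contains [g] with [g * g = g + e]. *)
Lemma no_golden_corner (R : pzRingType) (e g : R) :
    e * e = e -> e * g = g -> g * e = g -> g * g = g + e -> unit_sqr_nil R ->
  e = 0.
Proof.
move=> ee eg ge gg nilR.
have e'g : (1 - e) * g = 0 by rewrite mulrBl mul1r eg subrr.
have ge' : g * (1 - e) = 0 by rewrite mulrBr mulr1 ge subrr.
have e'e : (1 - e) * e = 0 by rewrite mulrBl mul1r ee subrr.
have ee' : e * (1 - e) = 0 by rewrite mulrBr mulr1 ee subrr.
have e'e' : (1 - e) * (1 - e) = 1 - e by rewrite mulrBr mulr1 e'e subr0.
have gh : g * (g - e) = e by rewrite mulrBr gg ge addrAC subrr add0r.
have hg : (g - e) * g = e by rewrite mulrBl gg eg addrAC subrr add0r.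
have he' : (g - e) * (1 - e) = 0 by rewrite mulrBl ge' ee' subrr.
have e'h : (1 - e) * (g - e) = 0 by rewrite mulrBr e'g e'e subrr.
have [|m] := nilR (g + (1 - e)).
  exists (g - e + (1 - e)).
  move: (g - e) (1 - e) hg gh he' ge' e'g e'h e'e' (subrK e 1).
  move=> h e' hg gh he' ge' e'g e'h e'e' e'De; split.
    by rewrite mulrDr !mulrDl hg he' e'g e'e' addr0 add0r addrC.
  by rewrite mulrDr !mulrDl gh ge' e'h e'e' addr0 add0r addrC.
have -> : (g + (1 - e)) ^+ 2 - 1 = g.
  rewrite -[X in _ - X](subrK e); move: (1 - e) e'g ge' e'e' => e' e'g ge' e'e'.
  rewrite expr2 mulrDr !mulrDl e'g ge' e'e' gg addr0 add0r.
  by rewrite -[g + e + e']addrA [e + e']addrC addrK.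
(* Multiplying by the corner inverse g - e lowers the exponent. *)
elim: m => [|m IHm gm0].
  by rewrite expr0 => /(congr1 ( *%R e)); rewrite mulr1 mulr0.
have egm : e * g ^+ m = 0 by rewrite -hg -mulrA -exprS gm0 mulr0.
case: m IHm egm {gm0} => [_|m IHm]; first by rewrite mulr1.
by rewrite exprS mulrA eg -exprS.
Qed.

Lemma unit_sqr_nil_matrix_size (D : nzRingType) (n : nat) :
  unit_sqr_nil 'M[D]_n -> (n <= 1)%N.
Proof.
move=> nilM; rewrite leqNgt; apply/negP=> n_gt1.
pose a : 'I_n := Ordinal (ltnW n_gt1); pose b : 'I_n := Ordinal n_gt1.
pose E i j : 'M[D]_n := delta_mx i j.
have EE i j k l : E i j * E k l = if j == k then E i l else 0.
  have -> : E i j * E k l = E i j *m E k l by [].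
  have [->|jk] := eqVneq j k; first by rewrite mul_delta_mx.
  by rewrite mul_delta_mx_0.
have [ab ba] : (a == b) = false /\ (b == a) = false by [].
have simpE := (mulrDl, mulrDr, EE, eqxx, ab, ba, addr0, add0r).
have : E a a + E b b = 0.
  apply: (@no_golden_corner _ _ (E a a + E a b + E b a)) nilM;
    by rewrite !simpE // addrACA.
move=> /matrixP/(_ a a)/eqP.
by rewrite !mxE eqxx ab addr0 oner_eq0.
Qed.

(** * Division rings whose units square to 1 *)

(** A ring of characteristic p consisting of the multiples of 1 is the prime
    field. *)
Lemma ring_iso_Fp (D : nzRingType) (p : nat) :
    prime p -> p%:R = 0 :> D -> (forall x : D, exists k : nat, x = k%:R) ->
  ring_iso D 'F_p.
Proof.
move=> p_pr p0 Dnat; apply: ring_iso_sym.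
pose f (x : 'F_p) : D := (x : nat)%:R.
have fnat k : f k%:R = k%:R.
  rewrite /f val_Fp_nat // [in RHS](divn_eq k p).
  by rewrite natrD natrM p0 mulr0 add0r.
have fD x y : f (x + y) = f x + f y.
  by rewrite -[x]natr_Zp -[y]natr_Zp -natrD !fnat natrD.
have fB : zmod_morphism f.
  by move=> x y; rewrite -[in RHS](subrK y x) [in RHS]fD addrK.
have fM : monoid_morphism f.
  split; first by rewrite -[1]/(1%:R) fnat.
  by move=> x y; rewrite -[x]natr_Zp -[y]natr_Zp -natrM !fnat natrM.
pose fa := GRing.isZmodMorphism.Build _ _ f fB.
pose fm := GRing.isMonoidMorphism.Build _ _ f fM.
pose F : {rmorphism 'F_p -> D} := HB.pack f fa fm.
have Dfin (x : D) : exists y, F y == x.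
  by have [k ->] := Dnat x; exists k%:R; apply/eqP; exact: (fnat k).
exists F; exists (fun x => xchoose (Dfin x)).
  by move=> y; apply: (fmorph_inj F); apply/eqP; exact: (xchooseP (Dfin (F y))).
by move=> x; apply/eqP; exact: (xchooseP (Dfin x)).
Qed.

Lemma division_ring_expf_eq0 (D : nzRingType) (x : D) (m : nat) :
  division_ring D -> x ^+ m = 0 -> x = 0.
Proof.
move=> divD xm0; apply/eqP/negP => /negP/divD[y [yx xy]].
elim: m xm0 => [/eqP|m IHm]; first by rewrite oner_eq0.
by rewrite exprS => /(congr1 ( *%R y)); rewrite mulrA yx mul1r mulr0.
Qed.

Lemma division_ring_F2_or_F3 (D : nzRingType) :
    division_ring D -> unit_sqr_nil D ->
  ring_iso D 'F_2 \/ ring_iso D 'F_3.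
Proof.
move=> divD nilD.
have D3 (x : D) : [\/ x = 0, x = 1 | x = -1].
  have [->|x0] := eqVneq x 0; first exact: Or31.
  have [m /(division_ring_expf_eq0 divD)/eqP] := nilD x (divD x x0).
  have [->|x1] := eqVneq x 1; first by move=> _; apply: Or32.
  have [|y [yx1 _]] := divD (x - 1); first by rewrite subr_eq0.
  rewrite subr_sqr_1 => /eqP/(congr1 ( *%R y)).
  by rewrite mulrA yx1 mul1r mulr0 => /eqP; rewrite addr_eq0 => /eqP; apply: Or33.
have [two0|two_neq0] := eqVneq (2%:R : D) 0; [left | right].
  apply: ring_iso_Fp => // x; case: (D3 x) => ->.
  - by exists 0.
  - by exists 1%N.
  - by exists 1%N; apply/eqP; rewrite eq_sym -addr_eq0 -mulr2n two0.
have two_opp1 : 2%:R = -1 :> D.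
  case: (D3 2%:R) => // two; first by rewrite two eqxx in two_neq0.
  move/eqP: two; rewrite -subr_eq0 mulr2n addrK => /eqP/eqP.
  by rewrite oner_eq0.
apply: ring_iso_Fp => //; first by rewrite (natrD _ 2 1) two_opp1 addNr.
move=> x; case: (D3 x) => ->.
- by exists 0.
- by exists 1%N.
- by exists 2.
Qed.

Lemma matrix1_iso (D : nzRingType) (n : nat) : n = 1 -> ring_iso 'M[D]_n D.
Proof.
move=> ->; apply: ring_iso_sym.
exists (@scalar_mx D 1 : {rmorphism D -> 'M[D]_1}).
exists (fun A : 'M[D]_1 => A 0 0) => [a|A]; first by rewrite mxE eqxx.
by rewrite [RHS]mx11_scalar.
Qed.

Lemma unit_sqr_nil_iso (R S : pzRingType) :
  ring_iso R S -> unit_sqr_nil R -> unit_sqr_nil S.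
Proof.
move=> /ring_isoP[f [g [fK gK]]] nilR u /(is_unit_rmorph g)/nilR[m gum0].
exists m; apply: (can_inj gK).
by rewrite rmorphXn rmorphB rmorphXn rmorph1 gum0 rmorph0.
Qed.

(** * The structure theorem *)

Lemma Fp_unit_sqr1 (R : pzRingType) (u : R) :
  ring_iso R 'F_2 \/ ring_iso R 'F_3 -> is_unit u -> u ^+ 2 = 1.
Proof.
case=> -[f /bij_inj injf] /(is_unit_rmorph f)[v [vu _]];
  apply: injf; rewrite rmorphXn rmorph1;
  have : f u != 0
    by apply: contra_eq_neq vu => ->; rewrite mulr0 eq_sym oner_neq0.
  by move: (f u) => [[|[|x]] ltx] // _; apply/val_inj.
by move: (f u) => [[|[|[|x]]] ltx] // _; apply/val_inj.
Qed.

Theorem theorem2p13 (R : nzRingType) (semisimpleR : semisimple R) :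
  two_sqrtJU R <->
  exists (k : nat) (Ri : 'I_k -> nzRingType),
    [/\ (0 < k)%N,
        forall i : 'I_k, ring_iso (Ri i) 'F_2 \/ ring_iso (Ri i) 'F_3 &
        ring_iso R (ring_prod (fun i : 'I_k => Ri i))].
Proof.
split=> [JU|[k [Ri [_ RiF [f /bij_inj injf]]]] u u_unit]; last first.
  exists 0; split; first by exists 1%N; split; rewrite ?expr1 //; apply: jacobson0.
  rewrite addr0; apply: injf; rewrite rmorphXn rmorph1; apply/ffunP=> i.
  rewrite -[LHS]/(ring_proj i _) -[RHS]/(ring_proj i _) rmorphXn rmorph1.
  exact: Fp_unit_sqr1 (RiF i) (is_unit_rmorph _ (is_unit_rmorph f u_unit)).
have [k [m [D [k_gt0 m_gt0 divD isoR]]]] := semisimpleR.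
have nilM i := unit_sqr_nil_component (divD i) isoR JU.
have isoMD i : ring_iso 'M[D i]_(m i) (D i).
  apply: matrix1_iso; apply/eqP.
  by rewrite eqn_leq m_gt0 (unit_sqr_nil_matrix_size (nilM i)).
exists k, D; split=> // [i|].
  exact: division_ring_F2_or_F3 (divD i) (unit_sqr_nil_iso (isoMD i) (nilM i)).
exact: ring_iso_trans isoR (ring_prod_iso isoMD).
Qed.
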